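(* Let $(\mathfrak g,[\cdot,\cdot,\cdot]_{\mathfrak g})$ be a finite-dimensional $3$-Lie algebra over $\mathbb R$ or $\mathbb C$. Then $\mathfrak g$ has an abelian product structure if and only if $\mathfrak g$ admits a decomposition $\mathfrak g=\mathfrak g_+\oplus\mathfrak g_-$ (direct sum of vector spaces), where $\mathfrak g_+$ and $\mathfrak g_-$ are nonzero abelian subalgebras of $\mathfrak g$.
   Context: A $3$-Lie algebra is a vector space $\mathfrak g$ with a trilinear skew-symmetric bracket $[\cdot,\cdot,\cdot]_{\mathfrak g}$ satisfying $[x,y,[z,w,v]]=[[x,y,z],w,v]+[z,[x,y,w],v]+[z,w,[x,y,v]]$. A subalgebra $\mathfrak a$ is abelian if $[\mathfrak a,\mathfrak a,\mathfrak a]_{\mathfrak g}=0$. An almost product structure on $\mathfrak g$ is a linear map $E:\mathfrak g\to\mathfrak g$ with $E^2=\mathrm{Id}$ and $E\neq\pm\mathrm{Id}$. It is called an abelian product structure if $[x,y,z]_{\mathfrak g}=-[x,Ey,Ez]_{\mathfrak g}-[Ex,y,Ez]_{\mathfrak g}-[Ex,Ey,z]_{\mathfrak g}$ for all $x,y,z\in\mathfrak g$. *)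

(* Defs.v *)
From HB Require Import structures.
From mathcomp Require Import all_boot all_order all_algebra.
From mathcomp Require Import reals.
From mathcomp Require Import complex.

Set Implicit Arguments.
Unset Strict Implicit.
Unset Printing Implicit Defensive.

Import GRing.Theory.
Local Open Scope ring_scope.

(* Any [R : realType] is a copy of the field of real numbers. *)
Inductive real_or_complex (R : realType) : fieldType -> Prop :=
  | RealScalars : real_or_complex R R
  | ComplexScalars : real_or_complex R (R[i])%C.

(* The swaps of adjacent arguments generate the symmetric group on the three
   arguments, so they express full skew-symmetry. *)
Record lie3_bracket (K : fieldType) (g : vectType K) := Lie3Bracket {
  bracket :> g -> g -> g -> g;
  bracket_linear1 : forall y z, linear (fun x => bracket x y z);
  bracket_linear2 : forall x z, linear (fun y => bracket x y z);
  bracket_linear3 : forall x y, linear (fun z => bracket x y z);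
  bracket_skew12 : forall x y z, bracket y x z = - bracket x y z;
  bracket_skew23 : forall x y z, bracket x z y = - bracket x y z;
  bracket_fundamental : forall x y z w v,
    bracket x y (bracket z w v) =
      bracket (bracket x y z) w v + bracket z (bracket x y w) v
      + bracket z w (bracket x y v) }.

Section Lie3.
Variables (K : fieldType) (g : vectType K) (br : lie3_bracket g).
Implicit Types (E : 'End(g)) (a : {vspace g}).

Definition subalgebra a : Prop :=
  forall x y z, x \in a -> y \in a -> z \in a -> br x y z \in a.

Definition abelian_subalgebra a : Prop :=
  subalgebra a /\
  forall x y z, x \in a -> y \in a -> z \in a -> br x y z = 0.

Definition almost_product_structure E : Prop :=
  [/\ (E \o E)%VF = \1%VF, E <> \1%VF & E <> - \1%VF].

Definition abelian_product_structure E : Prop :=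
  almost_product_structure E /\
  forall x y z,
    br x y z = - br x (E y) (E z) - br (E x) y (E z) - br (E x) (E y) z.

End Lie3.

(* Main.v *)
Require Import Defs.
From HB Require Import structures.
From mathcomp Require Import all_boot all_order all_algebra.
From mathcomp Require Import reals.
From mathcomp Require Import complex.

Set Implicit Arguments.
Unset Strict Implicit.
Unset Printing Implicit Defensive.

Import GRing.Theory.
Local Open Scope ring_scope.

(** Over a field where [2] is invertible, an involution [E] with [E <> 1] and
    [E <> -1] is the same thing as a splitting of the space into two nonzero
    summands, the eigenspaces of [E] for [1] and [-1]. It remains to compare the
    bracket conditions on the two sides.

    If [E] acts on a subspace as a scalar [s] with [s * s = 1], then the
    abelian product identity reads [[x, y, z] = - 3 [x, y, z]] there, so the
    bracket vanishes on each eigenspace ([eigen_abelian]).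

    Conversely write [x = a + a'], [y = b + b'], [z = c + c'] along the
    splitting, so that [E x = a - a'] and so on. On arguments with signs
    [s, t, u], the sum [[x,y,z] + [x,Ey,Ez] + [Ex,y,Ez] + [Ex,Ey,z]] is the
    bracket multiplied by [1 + t u + s u + s t], which is [4] when the three
    signs agree and [0] otherwise. The sum is therefore
    [4 [a,b,c] + 4 [a',b',c']] ([bracket_polarization]), and both terms vanish
    when the two summands are abelian. *)

Lemma real_or_complex_neq2 (R : realType) (K : fieldType) :
  real_or_complex R K -> 2%:R != 0 :> K.
Proof. by case; rewrite Num.Theory.pnatr_eq0. Qed.

Section Bracket.
Variables (K : fieldType) (g : vectType K) (br : lie3_bracket g).
Implicit Types (x y z : g) (s : K).

Lemma bracketD1 x x' y z : br (x + x') y z = br x y z + br x' y z.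
Proof. by have := bracket_linear1 br y z 1 x x'; rewrite !scale1r. Qed.

Lemma bracketD2 x y y' z : br x (y + y') z = br x y z + br x y' z.
Proof. by have := bracket_linear2 br x z 1 y y'; rewrite !scale1r. Qed.

Lemma bracketD3 x y z z' : br x y (z + z') = br x y z + br x y z'.
Proof. by have := bracket_linear3 br x y 1 z z'; rewrite !scale1r. Qed.

Lemma bracketZ1 s x y z : br (s *: x) y z = s *: br x y z.
Proof.
have br0 : br 0 y z = 0.
  by apply: (addrI (br 0 y z)); rewrite -bracketD1 !addr0.
by have := bracket_linear1 br y z s x 0; rewrite br0 !addr0.
Qed.

Lemma bracketZ2 s x y z : br x (s *: y) z = s *: br x y z.
Proof.
by rewrite bracket_skew12 bracketZ1 -scalerN -bracket_skew12.
Qed.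

Lemma bracketZ3 s x y z : br x y (s *: z) = s *: br x y z.
Proof.
by rewrite bracket_skew23 bracketZ2 -scalerN -bracket_skew23.
Qed.

Lemma bracketN1 x y z : br (- x) y z = - br x y z.
Proof. by rewrite -scaleN1r bracketZ1 scaleN1r. Qed.

Lemma bracketN2 x y z : br x (- y) z = - br x y z.
Proof. by rewrite -scaleN1r bracketZ2 scaleN1r. Qed.

Lemma bracketN3 x y z : br x y (- z) = - br x y z.
Proof. by rewrite -scaleN1r bracketZ3 scaleN1r. Qed.

Lemma sum_mixed_signs (p q r t : g) :
  p + q + (r + t) + (p - q + (- r + t)) = (p + t) *+ 2.
Proof.
rewrite mulr2n addrACA [p + q + _]addrACA [r + t + _]addrACA !subrr addr0 add0r.
by rewrite addrACA.
Qed.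

(** The mixed terms [br x b c'] and [br x b' c] occur with opposite signs in
    the two brackets and cancel. *)
Lemma bracket_polarization23 x b b' c c' :
  br x (b + b') (c + c') + br x (b - b') (c - c') =
    (br x b c + br x b' c') *+ 2.
Proof.
rewrite !bracketD2 !bracketD3 !bracketN2 !bracketN3 opprK.
exact: sum_mixed_signs.
Qed.

(** With [x = a + a'] and [E x = a - a'], and likewise for [y] and [z], the left
    side is [x, y, z] + [x, Ey, Ez] + [Ex, y, Ez] + [Ex, Ey, z], so its vanishing
    is the abelian product identity. *)
Lemma bracket_polarization a a' b b' c c' :
  br (a + a') (b + b') (c + c') + br (a + a') (b - b') (c - c')
    + (br (a - a') (b + b') (c - c') + br (a - a') (b - b') (c + c'))
  = (br a b c + br a' b' c') *+ 4.
Proof.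
(* The second pair is an instance of the first with [- c'] for [c']. *)
have := bracket_polarization23 (a - a') b b' c (- c').
rewrite opprK bracketN3 => ->; rewrite bracket_polarization23 -mulrnDl.
rewrite !bracketD1 !bracketN1 opprD opprK (mulrnA _ 2 2); congr (_ *+ 2).
exact: sum_mixed_signs.
Qed.

(** The scalar is kept general so that [s = 1] and [s = -1] are handled at once:
    every bracket in the identity carries the factor [s * s] or none. *)
Lemma eigen_abelian (E : 'End(g)) s (a : {vspace g}) :
    2%:R != 0 :> K -> abelian_product_structure br E -> s * s = 1 ->
  (forall x, x \in a -> E x = s *: x) -> abelian_subalgebra br a.
Proof.
move=> nz2 [_ brE] ss1 Ea.
have br0 x y z : x \in a -> y \in a -> z \in a -> br x y z = 0.
  move=> xa ya za; have := brE x y z.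
  rewrite !Ea // !(bracketZ1, bracketZ2, bracketZ3) !scalerA ss1 !scale1r.
  move/eqP; rewrite -!opprD -addr_eq0 => /eqP br4.
  have /eqP : (2%:R * 2%:R) *: br x y z = 0.
    by rewrite -scalerA !scaler_nat -mulrnA -br4 -!addrA.
  by rewrite scaler_eq0 mulf_eq0 (negPf nz2) /= => /eqP.
by split=> // x y z xa ya za; rewrite br0 ?mem0v.
Qed.

End Bracket.

Section Involution.
Variables (K : fieldType) (g : vectType K).
Hypothesis nz2 : 2%:R != 0 :> K.
Implicit Types (E : 'End(g)) (s : K).

Lemma eqN_eq0 (x : g) : x = - x -> x = 0.
Proof.
move/eqP; rewrite -addr_eq0 -mulr2n -scaler_nat scaler_eq0 (negPf nz2) /=.
by move/eqP.
Qed.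

Lemma leigenspaceP E s (x : g) :
  reflect (E x = s *: x) (x \in passmx.leigenspace E s).
Proof.
by apply: (iffP eqlfunP); rewrite !lfun_simp.
Qed.

Lemma involution_eigenvector E s x :
  (E \o E)%VF = \1%VF -> s * s = 1 -> E x + s *: x \in passmx.leigenspace E s.
Proof.
move=> EE ss1; apply/leigenspaceP.
rewrite linearD linearZ /= -comp_lfunE EE id_lfunE.
by rewrite scalerDr scalerA ss1 scale1r addrC.
Qed.

(** The vectors [E x + s *: x] all lie in the eigenspace for [s]; if it were
    trivial they would vanish, and [E] would be the scalar [- s]. *)
Lemma involution_leigenspace_neq0 E s :
    (E \o E)%VF = \1%VF -> s * s = 1 -> E <> (- s) *: \1%VF ->
  passmx.leigenspace E s <> 0%VS.
Proof.
move=> EE ss1 neqE U0; apply: neqE; apply/lfunP=> x.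
have := involution_eigenvector x EE ss1; rewrite U0 memv0 addr_eq0 => /eqP ->.
by rewrite !lfun_simp scaleNr.
Qed.

Lemma vspace_neq0_ex (U : {vspace g}) : U <> 0%VS -> exists2 x, x \in U & x != 0.
Proof.
by move/eqP => U0; exists (vpick U); rewrite ?memv_pick ?vpick0.
Qed.

End Involution.

Theorem corollary5p9 (R : realType) (K : fieldType)
    (hK : real_or_complex R K) (g : vectType K) (br : lie3_bracket g) :
  (exists E : 'End(g), abelian_product_structure br E) <->
  (exists gp gm : {vspace g},
     [/\ (gp + gm)%VS = fullv, directv (gp + gm),
         gp <> 0%VS /\ gm <> 0%VS,
         abelian_subalgebra br gp & abelian_subalgebra br gm]).
Proof.
have nz2 := real_or_complex_neq2 hK; split.
  case=> E brE; have [[EE neq1 neqN1] _] := brE.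
  have ssN1 : (-1) * (-1) = 1 :> K by rewrite mulrNN mulr1.
  exists (passmx.leigenspace E 1), (passmx.leigenspace E (-1)); split.
  - apply/eqP; rewrite eqEsubv subvf /=; apply/subvP=> x _.
    have -> : x = 2%:R^-1 *: (E x + 1 *: x) - 2%:R^-1 *: (E x + (-1) *: x).
      rewrite -scalerBr scale1r scaleN1r opprB [E x + x]addrC addrACA subrr addr0.
      by rewrite -mulr2n -[x *+ 2]scaler_nat scalerA mulVf ?scale1r.
    by rewrite memv_add ?rpredN // rpredZ // involution_eigenvector ?mulr1.
  - apply/directv_addP/eqP.
    rewrite -subv0; apply/subvP=> x; rewrite memv_cap memv0.
    case/andP=> /leigenspaceP Ex1 /leigenspaceP ExN1; apply/eqP.
    by apply: eqN_eq0 => //; rewrite -scaleN1r -ExN1 Ex1 scale1r.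
  - split; apply: involution_leigenspace_neq0; rewrite ?mulr1 //.
      by rewrite scaleN1r.
    by rewrite opprK scale1r.
  - by apply: (eigen_abelian nz2 brE (mulr1 1)) => x /leigenspaceP.
  - by apply: (eigen_abelian nz2 brE ssN1) => x /leigenspaceP.
case=> gp [gm [gfull gdir [gp0 gm0] [_ abp] [_ abm]]].
have capg : (gp :&: gm)%VS = 0%VS by apply/directv_addP.
pose P := daddv_pi gp gm; pose M := daddv_pi gm gp.
have Pgp x : P x \in gp by exact: memv_pi.
have Mgm x : M x \in gm by exact: memv_pi.
have PM x : P x + M x = x by apply: daddv_pi_add; rewrite // gfull memvf.
have P1 x : x \in gp -> P x = x by exact: daddv_pi_id.
have M1 x : x \in gm -> M x = x by apply: daddv_pi_id; rewrite capvC.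
pose E := P - M.
have EE x : E x = P x - M x by rewrite !lfun_simp.
have Ep x : x \in gp -> E x = x.
  move=> xp; move: (PM x); rewrite EE P1 // => /(canRL (addKr _)) ->.
  by rewrite addNr subr0.
have Em x : x \in gm -> E x = - x.
  move=> xm; move: (PM x); rewrite EE M1 // => /(canRL (addrK _)) ->.
  by rewrite subrr add0r.
exists E; split; [split|].
- apply/lfunP=> x; rewrite comp_lfunE [E x]EE linearB /= Ep // Em // opprK.
  by rewrite PM id_lfunE.
- have [x xm x0] := vspace_neq0_ex gm0; move=> E1; move/eqP: x0; apply.
  by apply: eqN_eq0 => //; rewrite -(Em x xm) E1 id_lfunE.
- have [x xp x0] := vspace_neq0_ex gp0; move=> E1; move/eqP: x0; apply.
  by apply: eqN_eq0 => //; rewrite -[LHS](Ep x xp) E1 !lfun_simp.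
move=> x y z; have := bracket_polarization br (P x) (M x) (P y) (M y) (P z) (M z).
rewrite (abp _ _ _ (Pgp x) (Pgp y) (Pgp z)) (abm _ _ _ (Mgm x) (Mgm y) (Mgm z)).
rewrite -!EE !PM addr0 mul0rn => /eqP.
by rewrite -addrA addr_eq0 => /eqP {1}->; rewrite !opprD -!addrA.
Qed.
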